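(* Let $D$ be a Prüfer domain with quotient field $K\ne D$, let $A$ be a $D$-algebra that is torsion-free and finitely generated as a $D$-module and such that $A\cap K=D$, and let $S\subset A$ be a finite subset. Then $\mathrm{Int}_K(S,A)$ is a Prüfer domain if and only if for each $a\in S$, $\mathrm{Int}_K(\{a\},A)$ is a Prüfer domain.
   Context: Algebras are associative and unital, not necessarily commutative. $K$ and $A$ are embedded in $B=A\otimes_D K=(D\setminus\{0\})^{-1}A$ via $k\mapsto 1\otimes k$ and $a\mapsto a\otimes 1$; $A\cap K=D$ is meant inside $B$. For $S\subseteq A$, $\mathrm{Int}_K(S,A)=\{f\in K[X]\mid f(S)\subseteq A\}$. *)

(* Defs.v *)
From HB Require Import structures.
From mathcomp Require Import all_boot all_algebra generic_quotient.
From mathcomp Require Import ring.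
From mathcomp Require Import boolp classical_sets functions cardinality.

Set Implicit Arguments.
Unset Strict Implicit.
Unset Printing Implicit Defensive.

Import GRing.Theory.

Local Open Scope ring_scope.
Local Open Scope quotient_scope.
Local Open Scope classical_set_scope.

Notation "x %:F" := (@FracField.tofrac _ x) : ring_scope.

Section Prufer.
Variable R : idomainType.
Local Notation F := {fraction R}.

Definition fractional_ideal (J : set F) : Prop :=
  [/\ J 0,
      forall x y, J x -> J y -> J (x + y),
      forall (r : R) x, J x -> J (r%:F * x) &
      exists2 d : R, d != 0 & forall x, J x -> exists r : R, d%:F * x = r%:F].

Definition ideal_prod (I J : set F) : set F :=
  [set x | exists (n : nat) (u v : 'I_n -> F),
    [/\ forall i, I (u i), forall i, J (v i) & x = \sum_i u i * v i]].

Definition invertible_ideal (I : set F) : Prop :=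
  exists2 J : set F, fractional_ideal J &
    ideal_prod I J = range (@FracField.tofrac R).

(* The image in F of the ideal of R generated by s. *)
Definition fg_ideal (s : seq R) : set F :=
  [set x | exists c : 'I_(size s) -> R, x = (\sum_i c i * s`_i)%:F].

(* The ideal generated by s is nonzero iff s has a nonzero entry. *)
Definition prufer_domain : Prop :=
  forall s : seq R, has (fun x => x != 0) s -> invertible_ideal (fg_ideal s).

End Prufer.

Arguments prufer_domain R : clear implicits.

Section Modules.
Variables (D : idomainType) (V : lmodType D).

Definition torsion_free : Prop :=
  forall (d : D) (v : V), d *: v = 0 -> d = 0 \/ v = 0.

Definition finitely_generated : Prop :=
  exists (n : nat) (e : 'I_n -> V),
    forall v : V, exists c : 'I_n -> D, v = \sum_i c i *: e i.

End Modules.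

Arguments torsion_free {D} V.
Arguments finitely_generated {D} V.

Lemma frac_numden (D : idomainType) (k : {fraction D}) :
  k = (\n_(repr k))%:F / (\d_(repr k))%:F.
Proof.
have d0 := denom_ratioP (repr k).
apply: (canRL (mulfK _)); first by rewrite tofrac_eq0.
rewrite -{1}[k]reprK; move: (repr k) d0 => x d0.
unlock FracField.tofrac; rewrite -[LHS]FracField.pi_mul.
apply/eqmodP; rewrite /= FracField.equivfE /FracField.mulf.
by rewrite !numden_Ratio ?mulr1 ?oner_eq0 // mulrC.
Qed.

(* The localization (D \ {0})^-1 A of a torsion-free D-algebra A, as an algebra
   over {fraction D}.  Torsion-freeness makes a/d = a'/d' amount to
   d' *: a = d *: a', and makes the localization a nonzero ring. *)
Module FracAlg.
Section FracAlg.
Variables (D : idomainType) (A : algType D) (tf : torsion_free A).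
Local Notation K := {fraction D}.

Inductive preloc := Preloc { pl :> A * D; _ : pl.2 != 0 }.
HB.instance Definition _ := [isSub for pl].
HB.instance Definition _ := [Choice of preloc by <:].

Lemma den_neq0 (x : preloc) : x.2 != 0. Proof. by case: x. Qed.

Lemma scale_inj (d : D) (a b : A) : d != 0 -> d *: a = d *: b -> a = b.
Proof.
move=> d0 /eqP; rewrite -subr_eq0 -scalerBr => /eqP /tf [/eqP|/eqP].
  by rewrite (negPf d0).
by rewrite subr_eq0 => /eqP.
Qed.

Definition equivl (x y : preloc) := y.2 *: x.1 == x.2 *: y.1.

Lemma equivl_refl : reflexive equivl. Proof. by move=> x; exact: eqxx. Qed.
Lemma equivl_sym : symmetric equivl. Proof. by move=> x y; exact: eq_sym. Qed.
Lemma equivl_trans : transitive equivl.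
Proof.
move=> y x z /eqP xy /eqP yz; apply/eqP; apply: (scale_inj (den_neq0 y)).
by rewrite scalerA mulrC -scalerA xy scalerA mulrC -scalerA yz !scalerA mulrC.
Qed.

Canonical equivl_equiv := EquivRel equivl equivl_refl equivl_sym equivl_trans.

Definition type := {eq_quot equivl}.
HB.instance Definition _ : EqQuotient _ equivl type := EqQuotient.on type.
HB.instance Definition _ := Choice.on type.

Lemma den1 (a : A) : (a, 1 : D).2 != 0. Proof. exact: oner_neq0. Qed.

(* The class of a/d; junk value a/1 for d = 0. *)
Definition mk (a : A) (d : D) : type :=
  \pi_type (insubd (Preloc (den1 a)) (a, d)).

Definition num (x : type) : A := (pl (repr x)).1.
Definition den (x : type) : D := (pl (repr x)).2.

Lemma den0 x : den x != 0. Proof. exact: den_neq0. Qed.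

Lemma mkE (a a' : A) (d d' : D) : d != 0 -> d' != 0 ->
  d' *: a = d *: a' -> mk a d = mk a' d'.
Proof.
by move=> d0 d0' e; apply/eqmodP; rewrite /= /equivl !insubdK //= e.
Qed.

Lemma mk_eq (a a' : A) (d d' : D) : d != 0 -> d' != 0 ->
  mk a d = mk a' d' -> d' *: a = d *: a'.
Proof.
by move=> d0 d0' /eqmodP; rewrite /= /equivl !insubdK //= => /eqP.
Qed.

Lemma numdenK x : mk (num x) (den x) = x.
Proof.
rewrite -[RHS]reprK /mk; set p := insubd _ _.
have -> // : p = repr x; apply: val_inj.
by rewrite /p insubdK /num /den -?surjective_pairing //; exact: den_neq0.
Qed.

Lemma numden_mk (a : A) (d : D) : d != 0 ->
  d *: num (mk a d) = den (mk a d) *: a.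
Proof.
by move=> d0; apply: mk_eq; rewrite ?den0 // numdenK.
Qed.

Lemma mkP (P : type -> Prop) :
  (forall (a : A) (d : D), d != 0 -> P (mk a d)) -> forall x, P x.
Proof. by move=> h x; rewrite -(numdenK x); apply: h; exact: den0. Qed.

Definition iota (a : A) : type := mk a 1.
Definition add x y := mk (den y *: num x + den x *: num y) (den x * den y).
Definition opp x := mk (- num x) (den x).
Definition mul x y := mk (num x * num y) (den x * den y).
Definition scale (k : K) x := mk (\n_(repr k) *: num x) (\d_(repr k) * den x).

Let s1 := oner_neq0 D.
Let Mn0 (d e : D) : d != 0 -> e != 0 -> d * e != 0.
Proof. by move=> *; rewrite mulf_neq0. Qed.

Lemma addE (a : A) (d : D) (b : A) (e : D) : d != 0 -> e != 0 ->
  add (mk a d) (mk b e) = mk (e *: a + d *: b) (d * e).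
Proof.
move=> d0 e0; rewrite /add.
move: (numden_mk a d0) (numden_mk b e0) (den0 (mk a d)) (den0 (mk b e)).
move: (num (mk a d)) (den (mk a d)) (num (mk b e)) (den (mk b e)).
move=> a1 d1 b1 e1 Ha Hb d10 e10.
apply: mkE; rewrite ?Mn0 // !scalerDr !scalerA; congr (_ + _).
  rewrite (_ : d * e * e1 = e * e1 * d); last by ring.
  rewrite -scalerA Ha scalerA; congr (_ *: _); ring.
rewrite (_ : d * e * d1 = d * d1 * e); last by ring.
rewrite -scalerA Hb scalerA; congr (_ *: _); ring.
Qed.

Lemma oppE (a : A) (d : D) : d != 0 -> opp (mk a d) = mk (- a) d.
Proof.
move=> d0; apply: mkE; rewrite ?den0 //.
by rewrite !scalerN numden_mk.
Qed.

Lemma mulE (a : A) (d : D) (b : A) (e : D) : d != 0 -> e != 0 ->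
  mul (mk a d) (mk b e) = mk (a * b) (d * e).
Proof.
move=> d0 e0; apply: mkE; rewrite ?Mn0 ?den0 //.
rewrite -!scalerA scalerAr (numden_mk b e0) scalerAl (numden_mk a d0).
by rewrite -scalerAl -scalerAr.
Qed.

Lemma scaleE (n m : D) (a : A) (d : D) : m != 0 -> d != 0 ->
  scale (n%:F / m%:F) (mk a d) = mk (n *: a) (m * d).
Proof.
move=> m0 d0; set k := _ / _; have /eqP := frac_numden k.
rewrite /scale; move: (denom_ratioP (repr k)).
move: (\n_(repr k)) (\d_(repr k)) => n1 m1 m10.
rewrite /k eqr_div ?tofrac_eq0 // -!tofracM tofrac_eq => /eqP e.
apply: mkE; rewrite ?Mn0 ?den0 //.
rewrite !scalerA (_ : m * d * n1 = n1 * m * d); last by ring.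
rewrite -e -[LHS]scalerA numden_mk // !scalerA; congr (_ *: _); ring.
Qed.

Lemma fracP (P : K -> Prop) :
  (forall n m : D, m != 0 -> P (n%:F / m%:F)) -> forall k, P k.
Proof. by move=> h k; rewrite (frac_numden k); apply/h/denom_ratioP. Qed.

Lemma addA : associative add.
Proof.
elim/mkP=> a d d0; elim/mkP=> b e e0; elim/mkP=> c f f0.
rewrite !addE ?Mn0 // !scalerDr !scalerA !addrA mulrA.
by congr (mk (_ *: _ + _ *: _ + _) _); ring.
Qed.

Lemma addC : commutative add.
Proof.
elim/mkP=> a d d0; elim/mkP=> b e e0.
by rewrite !addE // addrC mulrC.
Qed.

Lemma add0 : left_id (iota 0) add.
Proof.
by elim/mkP=> a d d0; rewrite addE ?s1 // scaler0 add0r scale1r mul1r.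
Qed.

Lemma addN : left_inverse (iota 0) opp add.
Proof.
elim/mkP=> a d d0; rewrite oppE // addE //; apply: mkE; rewrite ?Mn0 ?s1 //.
by rewrite scalerN addNr !scaler0.
Qed.

HB.instance Definition _ := GRing.isZmodule.Build type addA addC add0 addN.

Lemma mulA : associative mul.
Proof.
elim/mkP=> a d d0; elim/mkP=> b e e0; elim/mkP=> c f f0.
by rewrite !mulE ?Mn0 // !mulrA.
Qed.

Lemma mul1 : left_id (iota 1) mul.
Proof. by elim/mkP=> a d d0; rewrite mulE ?s1 // !mul1r. Qed.

Lemma mulr1_ : right_id (iota 1) mul.
Proof. by elim/mkP=> a d d0; rewrite mulE ?s1 // !mulr1. Qed.

Lemma mulDl : left_distributive mul add.
Proof.
elim/mkP=> a d d0; elim/mkP=> b e e0; elim/mkP=> c f f0.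
rewrite addE // !mulE ?Mn0 // addE ?Mn0 //; apply: mkE; rewrite ?Mn0 //.
rewrite mulrDl -!scalerAl !scalerDr !scalerA.
by congr (_ *: _ + _ *: _); ring.
Qed.

Lemma mulDr : right_distributive mul add.
Proof.
elim/mkP=> a d d0; elim/mkP=> b e e0; elim/mkP=> c f f0.
rewrite addE // !mulE ?Mn0 // addE ?Mn0 //; apply: mkE; rewrite ?Mn0 //.
rewrite mulrDr -!scalerAr !scalerDr !scalerA.
by congr (_ *: _ + _ *: _); ring.
Qed.

Lemma one_neq0 : iota 1 != iota 0.
Proof.
apply/eqP => /(mk_eq s1 s1) /eqP.
by rewrite !scale1r oner_eq0.
Qed.

HB.instance Definition _ :=
  GRing.Zmodule_isNzRing.Build type mulA mul1 mulr1_ mulDl mulDr one_neq0.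

Lemma scaleA (k l : K) (x : type) : scale k (scale l x) = scale (k * l) x.
Proof.
elim/fracP: k => n m m0; elim/fracP: l => n' m' m0'; elim/mkP: x => a d d0.
rewrite mulf_div -!tofracM !scaleE ?Mn0 //.
by rewrite scalerA mulrA.
Qed.

Lemma scale1 : left_id (1 : K) scale.
Proof.
move=> x; rewrite -[1](divr1 (1 : K)) -tofrac1; elim/mkP: x => a d d0.
by rewrite scaleE ?s1 // scale1r mul1r.
Qed.

Lemma scaleDr : right_distributive scale +%R.
Proof.
move=> k x y; elim/fracP: k => n m m0.
elim/mkP: x => a d d0; elim/mkP: y => b e e0.
change (scale (n%:F / m%:F) (add (mk a d) (mk b e)) =
  add (scale (n%:F / m%:F) (mk a d)) (scale (n%:F / m%:F) (mk b e))).
rewrite addE // !scaleE ?Mn0 // addE ?Mn0 //; apply: mkE; rewrite ?Mn0 //.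
rewrite !scalerDr !scalerA.
by congr (_ *: _ + _ *: _); ring.
Qed.

Lemma scaleDl (x : type) : {morph scale^~ x : k l / k + l}.
Proof.
move=> k l /=; elim/fracP: k => n m m0; elim/fracP: l => n' m' m0'.
elim/mkP: x => a d d0.
rewrite addf_div ?tofrac_eq0 // -!tofracM -tofracD !scaleE ?Mn0 //.
rewrite [RHS]addE ?Mn0 //; apply: mkE; rewrite ?Mn0 //.
rewrite scalerDl !scalerDr !scalerA.
by congr (_ *: _ + _ *: _); ring.
Qed.

HB.instance Definition _ :=
  GRing.Zmodule_isLmodule.Build K type scaleA scale1 scaleDr scaleDl.

Lemma scaleAl (k : K) (x y : type) : k *: (x * y) = (k *: x) * y.
Proof.
elim/fracP: k => n m m0; elim/mkP: x => a d d0; elim/mkP: y => b e e0.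
change (scale (n%:F / m%:F) (mul (mk a d) (mk b e)) =
  mul (scale (n%:F / m%:F) (mk a d)) (mk b e)).
by rewrite mulE // !scaleE ?Mn0 // mulE ?Mn0 // scalerAl mulrA.
Qed.

HB.instance Definition _ := GRing.Lmodule_isLalgebra.Build K type scaleAl.

Lemma scaleAr (k : K) (x y : type) : k *: (x * y) = x * (k *: y).
Proof.
elim/fracP: k => n m m0; elim/mkP: x => a d d0; elim/mkP: y => b e e0.
change (scale (n%:F / m%:F) (mul (mk a d) (mk b e)) =
  mul (mk a d) (scale (n%:F / m%:F) (mk b e))).
by rewrite mulE // !scaleE ?Mn0 // mulE ?Mn0 // scalerAr mulrCA.
Qed.

HB.instance Definition _ := GRing.Lalgebra_isAlgebra.Build K type scaleAr.

Lemma iota_zmod : zmod_morphism iota.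
Proof.
move=> a b; symmetry.
change (add (mk a 1) (opp (mk b 1)) = mk (a - b) 1).
by rewrite oppE ?s1 // addE ?s1 // !scale1r mulr1.
Qed.

Lemma iota_monoid : monoid_morphism iota.
Proof.
split=> // a b; symmetry.
change (mul (mk a 1) (mk b 1) = mk (a * b) 1).
by rewrite mulE ?s1 // mulr1.
Qed.

HB.instance Definition _ := GRing.isZmodMorphism.Build A type iota iota_zmod.
HB.instance Definition _ :=
  GRing.isMonoidMorphism.Build A type iota iota_monoid.

Lemma iotaZ (d : D) (a : A) : iota (d *: a) = d%:F *: iota a.
Proof.
rewrite -[d%:F]divr1 -tofrac1; symmetry.
change (scale (d%:F / 1%:F) (mk a 1) = mk (d *: a) 1).
by rewrite scaleE ?s1 // mulr1.
Qed.

Lemma iota_inj : injective iota.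
Proof. by move=> a b /(mk_eq s1 s1); rewrite !scale1r. Qed.

Lemma iota_frac (x : type) :
  exists (a : A) (d : D), d != 0 /\ x = (d%:F)^-1 *: iota a.
Proof.
elim/mkP: x => a d d0; exists a, d; split=> //.
rewrite -[_^-1]mul1r -tofrac1; symmetry.
change (scale (1%:F / d%:F) (mk a 1) = mk a d).
by rewrite scaleE ?s1 // scale1r mulr1.
Qed.

End FracAlg.
End FracAlg.
HB.export FracAlg.

Section IntegerValued.
Variables (D : idomainType) (A : algType D) (tf : torsion_free A).
Local Notation K := {fraction D}.
Local Notation B := (FracAlg.type tf).
Local Notation iota := (@FracAlg.iota D A tf).

(* A \cap K = D inside B, where k : K is identified with k%:A = k *: 1. *)
Definition meets_frac_in_base : Prop :=
  range iota `&` range (fun k : K => k%:A : B)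
    = range (fun d : D => (d%:F)%:A : B).

Definition intK (S : set A) : set {poly K} :=
  [set f | forall a, S a -> range iota (horner_alg (iota a : B) f)].

Definition intK_pred (S : set A) : {pred {poly K}} :=
  fun f => `[< intK S f >].

Variable S : set A.

Lemma intK_subring : subring_closed (intK_pred S).
Proof.
split.
- by apply/asboolP => a _; exists 1 => //; rewrite !rmorph1.
- move=> f g /asboolP hf /asboolP hg; apply/asboolP => a Sa.
  have [u _ hu] := hf a Sa; have [v _ hv] := hg a Sa.
  by exists (u - v) => //; rewrite !rmorphB /= hu hv.
- move=> f g /asboolP hf /asboolP hg; apply/asboolP => a Sa.
  have [u _ hu] := hf a Sa; have [v _ hv] := hg a Sa.
  by exists (u * v) => //; rewrite !rmorphM /= hu hv.
Qed.

HB.instance Definition _ :=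
  GRing.isSubringClosed.Build {poly K} (intK_pred S) intK_subring.

Inductive intK_ring := IntK { intK_val :> {poly K}; _ : intK_pred S intK_val }.

HB.instance Definition _ := [isSub for intK_val].
HB.instance Definition _ := [Choice of intK_ring by <:].
HB.instance Definition _ := [SubChoice_isSubComNzRing of intK_ring by <:].

Definition intK_unit : {pred intK_ring} :=
  fun f => ((f : {poly K}) \is a GRing.unit) && intK_pred S (f : {poly K})^-1.

Definition intK_inv (f : intK_ring) : intK_ring :=
  if f \in intK_unit then insubd f (f : {poly K})^-1 else f.

Lemma intK_mulV : {in intK_unit, left_inverse 1 intK_inv *%R}.
Proof.
move=> f uf; rewrite /intK_inv uf; have /andP[u i] := uf.
have e : intK_val (insubd f (f : {poly K})^-1) = (f : {poly K})^-1.
  exact: insubdK.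
by apply: val_inj; rewrite rmorphM rmorph1 /= e mulVr.
Qed.

Lemma intK_unitP f g : g * f = 1 -> intK_unit f.
Proof.
move=> /(congr1 val); rewrite rmorphM rmorph1 /= => gf.
have u : (f : {poly K}) \is a GRing.unit.
  by apply/unitrPr; exists (g : {poly K}); rewrite mulrC.
rewrite /intK_unit u /=.
by rewrite -[_^-1]mul1r -gf mulrK //; case: (g).
Qed.

Lemma intK_inv_out : {in [predC intK_unit], intK_inv =1 id}.
Proof. by move=> f; rewrite inE /= /intK_inv => /negPf ->. Qed.

HB.instance Definition _ := GRing.ComNzRing_hasMulInverse.Build intK_ring
  intK_mulV intK_unitP intK_inv_out.

Lemma intK_integral : GRing.integral_domain_axiom intK_ring.
Proof.
move=> f g /(congr1 val); rewrite rmorphM rmorph0 /= => /eqP.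
by rewrite mulf_eq0 -!(inj_eq val_inj) !rmorph0.
Qed.

HB.instance Definition _ :=
  GRing.ComUnitRing_isIntegral.Build intK_ring intK_integral.

End IntegerValued.

(* Main.v *)
Require Import Defs.
From HB Require Import structures.
From mathcomp Require Import all_boot all_algebra generic_quotient.
From mathcomp Require Import ring.
From mathcomp Require Import boolp classical_sets functions cardinality.
Local Open Scope ring_scope.
Local Open Scope classical_set_scope.

Set Implicit Arguments.
Unset Strict Implicit.
Unset Printing Implicit Defensive.

Import GRing.Theory.

(** A domain is Prüfer iff any two elements a, b are locally comparable: there is
    a splitting 1 = e + (1 - e) with a | e b and b | (1 - e) a.  For a ring
    m K[X] <= R <= K[X] with m <> 0 this amounts to: every coprime pair f, g of
    K[X] has a Bezout relation h g + k f = 1 with hg, hf, kg, kf in R.  The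
    condition passes to larger rings, which gives one implication.

    For the other one, let m_a be the minimal polynomial of a over K.  By
    Cayley-Hamilton the elements of Int({a}) are integral over D modulo m_a, and
    if Int({a}) is Prüfer, hence integrally closed, there are no other such
    polynomials.  Adding points one at a time, only the part of m_b coprime to
    the product m of the previous m_a matters, and Bezout relations for coprime
    moduli are glued by the Chinese remainder theorem. *)

(** * Prüfer domains through local comparability of pairs *)

Section PruferCriterion.
Variable R : idomainType.
Local Notation F := {fraction R}.

Definition locally_comparable : Prop :=
  forall a b : R, exists e x y, e * b = a * x /\ (1 - e) * a = b * y.

Lemma tofrac_injective : injective (@FracField.tofrac R).
Proof. by move=> x y /eqP; rewrite tofrac_eq => /eqP. Qed.

Lemma fractional_ideal_sum (J : set F) n (c : 'I_n -> R) (v : 'I_n -> F) :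
  fractional_ideal J -> (forall i, J (v i)) -> J (\sum_i (c i)%:F * v i).
Proof. by case=> J0 JD JM _ Jv; apply: big_ind => // i _; apply: JM. Qed.

(** An inverse [J] of the ideal [I] generated by [a] and [b] gives 1 = a p + b q with p, q in [J].
    Then e = a p, x = b p and y = a q lie in [R] because I J = R. *)
Lemma invertible_pair (a b : R) : invertible_ideal (fg_ideal [:: a; b]) ->
  exists e x y, e * b = a * x /\ (1 - e) * a = b * y.
Proof.
case=> J fJ IJ.
have Ia : fg_ideal [:: a; b] a%:F.
  exists (fun i => (i == 0 :> nat)%:R); congr (_%:F).
  by rewrite /= !big_ord_recl big_ord0 /= mul1r mul0r !addr0.
have Ib : fg_ideal [:: a; b] b%:F.
  exists (fun i => (i == 1 :> nat)%:R); congr (_%:F).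
  by rewrite /= !big_ord_recl big_ord0 /= mul1r mul0r add0r addr0.
have mulR u v : fg_ideal [:: a; b] u -> J v -> exists r : R, r%:F = u * v.
  move=> Iu Jv; suff [r _ <-] : range (@FracField.tofrac R) (u * v) by exists r.
  rewrite -IJ; exists 1, (fun=> u), (fun=> v); split=> //.
  by rewrite big_ord1.
have : range (@FracField.tofrac R) 1 by exists 1 => //; rewrite tofrac1.
rewrite -IJ => -[n [u [v [Iu Jv E]]]].
have [c cE] : exists c : 'I_n -> R * R,
    forall i, u i = a%:F * ((c i).1)%:F + b%:F * ((c i).2)%:F.
  suff /choice : forall i, exists c : R * R,
    u i = a%:F * (c.1)%:F + b%:F * (c.2)%:F by case=> c; exists c.
  move=> i; have [c ->] := Iu i; exists (c ord0, c (lift ord0 ord0)).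
  rewrite /= !big_ord_recl big_ord0 /= addr0 tofracD !tofracM.
  by congr (_ + _); rewrite mulrC.
have Jp := fractional_ideal_sum (fun i => (c i).1) fJ Jv.
have Jq := fractional_ideal_sum (fun i => (c i).2) fJ Jv.
set p := \sum_i _ in Jp; set q := \sum_i _ in Jq.
have Epq : a%:F * p + b%:F * q = 1.
  rewrite E !mulr_sumr -big_split /=; apply: eq_bigr => i _.
  by rewrite cE mulrDl !mulrA.
have [e eE] := mulR _ _ Ia Jp; have [x xE] := mulR _ _ Ib Jp.
have [y yE] := mulR _ _ Ia Jq.
exists e, x, y; split; apply: tofrac_injective.
  by rewrite !tofracM eE xE; ring.
by rewrite !tofracM tofracB tofrac1 eE yE -Epq; ring.
Qed.

(* The weights [d] form a partition of unity such that [s`_i] divides every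
   entry of [s] where [d i] is inverted. *)
Lemma locally_comparable_seq (b : R) (s : seq R) : locally_comparable ->
  exists d : nat -> R, \sum_(i < (size s).+1) d i = 1 /\
    forall i j, (i <= size s)%N -> (j <= size s)%N ->
      exists x, d i * (b :: s)`_j = (b :: s)`_i * x.
Proof.
move=> cmp; elim: s b => [|a s IHs] b.
  exists (fun=> 1); split=> [|[|i] [|j] // _ _]; first by rewrite big_ord1.
  by exists 1; rewrite mulrC.
have [d [d1 dP]] := IHs a.
have /choice[e /choice[x /choice[y eP]]] :
  forall i, exists e x y, e * b = (a :: s)`_i * x /\ (1 - e) * (a :: s)`_i = b * y.
  by move=> i; apply: cmp.
(* Each old weight [d i] is split by comparing the i-th entry with [b]: the part [d i * e i], where
   that entry divides [b], stays in place, and the parts where [b] divides the entry are collected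
   at the new head [b]. *)
exists (fun i => if i is i'.+1 then d i' * e i'
                 else \sum_(k < (size s).+1) d k * (1 - e k)).
split=> [|[|i] [|j] /= ilt jlt].
- rewrite big_ord_recl /= -big_split /= -[RHS]d1; apply: eq_bigr => i _.
  by rewrite -mulrDr subrK mulr1.
- by eexists; rewrite mulrC.
- have /choice[z zP] : forall k : 'I_(size s).+1,
      exists z, d k * (a :: s)`_j = (a :: s)`_k * z.
    by move=> k; apply: dP => //; rewrite -ltnS.
  exists (\sum_(k < (size s).+1) y k * z k).
  rewrite mulr_suml mulr_sumr; apply: eq_bigr => k _.
  rewrite (_ : _ * _ * _ = (1 - e k) * (d k * (a :: s)`_j)); last by ring.
  by rewrite zP [LHS]mulrA (eP k).2 mulrA.
- by exists (d i * x i); rewrite -mulrA (eP i).1 mulrCA.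
- have [z zP] := dP i j ilt jlt.
  by exists (e i * z); rewrite mulrAC zP; ring.
Qed.

Lemma prufer_domainP : prufer_domain R <-> locally_comparable.
Proof.
split=> [pR a b|cmp s].
  have [/hasPn ab0|] := boolP (~~ has (fun x => x != 0) [:: a; b]); last first.
    by rewrite negbK => /pR; apply: invertible_pair.
  have /eqP-> : a == 0 by rewrite -[_ == _]negbK ab0 ?mem_head.
  have /eqP-> : b == 0 by rewrite -[_ == _]negbK ab0 // !inE eqxx orbT.
  by exists 0, 0, 0; rewrite !mulr0.
case: s => // b s /hasP[x /(nthP 0)[k klt <-]] sk0.
have [d [d1 dP]] := locally_comparable_seq b s cmp.
set t := b :: s in klt sk0 dP *.
have It (i : 'I_(size t)) : fg_ideal t (t`_i)%:F.
  exists (fun j => (j == i)%:R); congr (_%:F).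
  rewrite (bigD1 i) //= eqxx mul1r big1 ?addr0 // => j /negPf->.
  by rewrite mul0r.
(* The inverse is the colon ideal of [t] in [F]; the nonzero entry at [k] is a common denominator
   for it. *)
exists [set z : F | forall i : 'I_(size t), exists r : R, (t`_i)%:F * z = r%:F].
  split=> [i|y z hy hz i|r z hz i|].
  - by exists 0; rewrite mulr0 tofrac0.
  - have [p pE] := hy i; have [q qE] := hz i.
    by exists (p + q); rewrite mulrDr pE qE tofracD.
  - by have [p pE] := hz i; exists (r * p); rewrite mulrCA pE tofracM.
  - by exists t`_k => // z /(_ (Ordinal klt)).
apply/seteqP; split=> [z [n [u [v [Iu Jv ->]]]]|_ [r _ <-]].
  suff /choice[w wE] : forall i, exists w : R, u i * v i = w%:F.
    exists (\sum_i w i) => //; rewrite rmorph_sum; apply: eq_bigr => i _.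
    by rewrite wE.
  move=> i; have [c ->] := Iu i; have /choice[w wE] := Jv i.
  exists (\sum_j c j * w j).
  rewrite !rmorph_sum mulr_suml; apply: eq_bigr => j _.
  by rewrite !rmorphM /= -mulrA wE.
(* Zero entries have weight zero, so the quotients by entries of [t] in the next witness take the
   harmless value 0 there. *)
have t0 i : (i < size t)%N -> t`_i = 0 -> d i = 0.
  move=> ilt ti0; have [z] := dP i k ilt klt.
  by rewrite ti0 mul0r => /eqP; rewrite mulf_eq0 (negPf sk0) orbF => /eqP.
exists (size t), (fun i => (t`_i)%:F), (fun i => (r * d i)%:F / (t`_i)%:F).
split=> [//|i j|].
  have [/t0->//|ti0] := eqVneq t`_i 0.
    by exists 0; rewrite mulr0 tofrac0 mul0r mulr0.
  have [z zE] := dP i j (ltn_ord i) (ltn_ord j).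
  exists (r * z); rewrite mulrA; apply: (canLR (mulfK _)).
    by rewrite tofrac_eq0.
  rewrite -!tofracM; congr (_%:F).
  have -> : t`_j * (r * d i) = r * (d i * t`_j) by ring.
  by rewrite zE; ring.
rewrite -[r in LHS]mulr1 -d1 mulr_sumr rmorph_sum; apply: eq_bigr => i _ /=.
have [/t0->//|ti0] := eqVneq t`_i 0; first by rewrite mulr0 tofrac0 mul0r mulr0.
by rewrite [RHS]mulrC divfK // tofrac_eq0.
Qed.

End PruferCriterion.

(** * Bezout relations with products in a subset of K[X] *)

Section SplittingSubrings.
Variable K : fieldType.
Implicit Types (f g h k m x : {poly K}) (R : set {poly K}).

(* For a subring R of K[X] containing a nonzero ideal of K[X] this says that R
   is a Prüfer domain; it is visibly inherited by larger subrings. *)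
Definition bezout_in R : Prop :=
  forall f g, coprimep f g -> exists h k,
    [/\ h * g + k * f = 1, R (h * g), R (h * f), R (k * g) & R (k * f)].

Lemma bezout_inS R1 R2 : R1 `<=` R2 -> bezout_in R1 -> bezout_in R2.
Proof.
by move=> sR R1P f g /R1P[h [k [E ? ? ? ?]]]; exists h, k; split=> //; apply: sR.
Qed.

Lemma bezout_inT : bezout_in setT.
Proof.
move=> f g /Bezout_eq1_coprimepP[[u v] /= E].
by exists v, u; split=> //; rewrite addrC.
Qed.

(* Two Bezout relations for (f, g) differ by a multiple of (f, -g), which the
   Chinese remainder theorem allows to interpolate between m1 and m2. *)
Lemma bezout_inI R1 R2 m1 m2 : coprimep m1 m2 ->
  (forall x y, R1 x -> R1 (x + m1 * y)) ->
  (forall x y, R2 x -> R2 (x + m2 * y)) ->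
  bezout_in R1 -> bezout_in R2 -> bezout_in (R1 `&` R2).
Proof.
move=> /Bezout_eq1_coprimepP[[u v] /= uv] R1m R2m R1P R2P f g fg.
have [h1 [k1 [E1 hg1 hf1 kg1 kf1]]] := R1P _ _ fg.
have [h2 [k2 [E2 hg2 hf2 kg2 kf2]]] := R2P _ _ fg.
(* The determinant [h2 * k1 - k2 * h1] of the two relations; Cramer's rule makes it the common
   quotient of [h2 - h1] by [f] and of [k1 - k2] by [g]. *)
pose w := (h2 - h1) * k1 - (k2 - k1) * h1.
have fw : f * w = h2 - h1.
  transitivity (h2 * (h1 * g + k1 * f) - h1 * (h2 * g + k2 * f)).
    by rewrite /w; ring.
  by rewrite E1 E2 !mulr1.
have gw : g * w = k1 - k2.
  transitivity (k1 * (h2 * g + k2 * f) - k2 * (h1 * g + k1 * f)).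
    by rewrite /w; ring.
  by rewrite E1 E2 !mulr1.
(* Since [w'] is 0 modulo [m1] and [w] modulo [m2], the pair corrected by [w'] agrees with the first
   relation modulo [m1] and with the second modulo [m2]. *)
pose w' := u * m1 * w.
have w'E : w' = w - v * m2 * w by rewrite /w' -[X in X - _]mul1r -uv; ring.
have hE : h1 + f * w' = h2 + m2 * (- (v * f * w)).
  by rewrite w'E mulrBr fw; ring.
have kE : k1 - g * w' = k2 + m2 * (v * g * w).
  by rewrite w'E mulrBr gw; ring.
exists (h1 + f * w'), (k1 - g * w'); split.
- by rewrite -E1; ring.
- split; last by rewrite hE mulrDl -mulrA; apply: R2m.
  have -> : (h1 + f * w') * g = h1 * g + m1 * (u * f * w * g) by rewrite /w'; ring.
  exact: R1m.
- split; last by rewrite hE mulrDl -mulrA; apply: R2m.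
  have -> : (h1 + f * w') * f = h1 * f + m1 * (u * f * w * f) by rewrite /w'; ring.
  exact: R1m.
- split; last by rewrite kE mulrDl -mulrA; apply: R2m.
  have -> : (k1 - g * w') * g = k1 * g + m1 * (- (u * g * w * g)) by rewrite /w'; ring.
  exact: R1m.
- split; last by rewrite kE mulrDl -mulrA; apply: R2m.
  have -> : (k1 - g * w') * f = k1 * f + m1 * (- (u * g * w * f)) by rewrite /w'; ring.
  exact: R1m.
Qed.

(** Divide [m] by its gcd with [q] until the gcd is constant. Each division lowers the degree and
    costs one factor [q]. *)
Lemma coprimep_part m q : m != 0 -> exists m' n,
  [/\ m' %| m, coprimep q m' & m %| q ^+ n * m'].
Proof.
elim: {m}(size m).+1 {-2}m (ltnSn (size m)) => // N IHN m ltm m0.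
have [cop|ncop] := boolP (coprimep q m).
  by exists m, 0%N; rewrite expr0 mul1r dvdpp.
have dm : gcdp q m %| m := dvdp_gcdr q m.
have mE := divpK dm.
have d0 : gcdp q m != 0 by rewrite gcdp_eq0 negb_and m0 orbT.
have lt : (size (m %/ gcdp q m)%R < N)%N.
  rewrite -ltnS; apply: leq_trans ltm; rewrite ltnS size_divp // ltn_subrL.
  rewrite size_poly_gt0 m0 andbT -ltnS prednK ?size_poly_gt0 //.
  by rewrite ltn_neqAle eq_sym size_poly_gt0 d0 andbT.
have m'0 : m %/ gcdp q m != 0 by rewrite dvdp_div_eq0.
have [m' [n [dv cop dvn]]] := IHN _ lt m'0.
exists m', n.+1; split=> //.
  by rewrite -mE dvdp_mulr.
by rewrite -mE exprSr mulrAC dvdp_mul // dvdp_gcdl.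
Qed.

Lemma annihilator_gen (B : nzRingType) (ev : {rmorphism {poly K} -> B}) m :
  m != 0 -> ev m = 0 ->
  exists2 m0 : {poly K}, m0 != 0 & forall p, (ev p = 0) <-> (m0 %| p).
Proof.
elim: {m}(size m).+1 {-2}m (ltnSn (size m)) => // N IHN m ltm m0 evm.
have [[p [p0 ltp evp]]|mmin] :=
  pselect (exists p : {poly K}, [/\ p != 0, (size p < size m)%N & ev p = 0]).
  by apply: (IHN p) => //; apply: leq_trans ltp _.
exists m => // p; split=> [evp|/dvdpP[q ->]]; last by rewrite rmorphM /= evm mulr0.
have [//|nd] := boolP (m %| p); case: mmin; exists (p %% m).
split; first by rewrite -[_ == _]/(m %| p).
  by rewrite ltn_modp.
rewrite (_ : p %% m = p - p %/ m * m).
  by rewrite rmorphB rmorphM /= evp evm mulr0 subr0.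
by rewrite {2}(divp_eq p m) addrC addKr.
Qed.

End SplittingSubrings.

(** * Integrality over D modulo a polynomial *)

Section IntegralModulo.
Variables (D : comNzRingType) (K : fieldType) (phi : {rmorphism D -> K}).
Implicit Types (m x : {poly K}).

(** The class of [x] in K[X]/(m) is integral over the image of [D]. *)
Definition integral_mod m x : Prop :=
  exists2 Q : {poly D}, Q \is monic & m %| map_poly phi Q \Po x.

Lemma integral_mod_dvd m m' x : m' %| m -> integral_mod m x -> integral_mod m' x.
Proof. by move=> dv [Q Qm dvQ]; exists Q => //; apply: dvdp_trans dvQ. Qed.

Lemma integral_modM m m' x :
  integral_mod m x -> integral_mod m' x -> integral_mod (m * m') x.
Proof.
move=> [Q Qm dQ] [Q' Qm' dQ']; exists (Q * Q'); first by rewrite monicMl.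
by rewrite !rmorphM /= dvdp_mul.
Qed.

Lemma integral_mod1 x : integral_mod 1 x.
Proof. by exists 1; rewrite ?monic1 // dvd1p. Qed.

Lemma integral_modX m n x : integral_mod m x -> integral_mod (m ^+ n) x.
Proof.
move=> mx; elim: n => [|n IHn]; first exact: integral_mod1.
by rewrite exprS; apply: integral_modM.
Qed.

Lemma integral_mod_add m x y : integral_mod m x -> integral_mod m (x + m * y).
Proof.
case=> Q Qm dQ; exists Q => //; move: dQ; move: (map_poly phi Q) => q.
suff dq : m %| (q \Po (x + m * y)) - (q \Po x).
  by move=> dx; have := dvdp_add dq dx; rewrite subrK.
elim/poly_ind: q => [|q c IHq]; first by rewrite !comp_poly0 subrr dvdp0.
rewrite !comp_polyD !comp_polyM !comp_polyX !comp_polyC.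
rewrite (_ : _ - _ = ((q \Po (x + m * y)) - (q \Po x)) * x +
  m * ((q \Po (x + m * y)) * y)); last by ring.
by rewrite dvdp_add // ?dvdp_mulr.
Qed.

(** The Bezout relation h + k x = 1 for the pair (x, 1) gives x = x (k x)^n + h x (1 + k x + ... +
    (k x)^(n-1)), where h x and k x lie in [R]. The first term is k^n x^(n+1): a monic equation of
    degree n + 1 lowers the power of x, and k^n x^i = (k x)^i k^(n-i) lies in [R] for i at most
    n. *)
Lemma bezout_in_integrally_closed (R : subringClosed {poly K}) m x :
  bezout_in [set` R] -> (forall p, m * p \in R) ->
  (forall d, (phi d)%:P \in R) -> integral_mod m x -> x \in R.
Proof.
move=> RP Rm Rphi [Q Qm /dvdpP[r rE]].
have [h [k]] := RP _ _ (coprimep1 x); rewrite !mulr1 /= => -[hk Rh Rhx Rk Rkx].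
(* The factor X makes the degree positive, of the form n + 1, even for [Q] = 1; the value at [x]
   remains a multiple of [m]. *)
pose Q' := Q * 'X.
have Q'm : Q' \is monic by rewrite monicMl ?monicX.
have sQ' : (size Q' = (size Q).-1.+2)%N.
  by rewrite size_mulX ?monic_neq0 // prednK // size_poly_gt0 monic_neq0.
have Q'x : map_poly phi Q' \Po x \in R.
  by rewrite !rmorphM /= map_polyX comp_polyX rE mulrAC mulrC Rm.
set n := (size Q).-1 in sQ'.
have : x * (k * x) ^+ n \in R.
  have xn : x ^+ n.+1 = (map_poly phi Q' \Po x) -
      \sum_(i < n.+1) (phi Q'`_i)%:P * x ^+ i.
    rewrite comp_polyE size_map_poly_id0; last first.
      by rewrite (monicP Q'm) rmorph1 oner_neq0.
    have lc : Q'`_n.+1 = 1 by have := monicP Q'm; rewrite /lead_coef sQ'.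
    rewrite sQ' big_ord_recr /= coef_map /= lc rmorph1 scale1r.
    rewrite addrC -addrA -sumrB big1 ?addr0 // => i _.
    by rewrite coef_map mul_polyC subrr.
  rewrite exprMn mulrCA -exprS xn mulrBr rpredB //.
    by rewrite rpredM // rpredX.
  rewrite mulr_sumr rpred_sum // => i _.
  have -> : k ^+ n = k ^+ i * k ^+ (n - i).
    by rewrite -exprD subnKC // -ltnS.
  rewrite [X in X \in _](_ : _ = (phi Q'`_i)%:P * (k ^+ i * x ^+ i) * k ^+ (n - i)).
    by rewrite -exprMn !rpredM ?rpredX.
  by ring.
move=> Rn; have -> : x = x * (k * x) ^+ n + h * x * \sum_(i < n) (k * x) ^+ i.
  have := subrX1 (k * x) n.
  have -> : k * x - 1 = - h by rewrite -hk; ring.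
  by move/(canRL (subrK _)) ->; ring.
by rewrite rpredD // rpredM // rpred_sum // => i _; rewrite rpredX.
Qed.

End IntegralModulo.

(** Cayley-Hamilton for a matrix of left multiplication by [b] on the generators. The generators may
    be dependent, so the matrix is a choice; its characteristic polynomial at [b] kills every
    generator, hence 1. *)
Lemma fg_integral (D : idomainType) (A : algType D) (b : A) :
  finitely_generated A ->
  exists2 Q : {poly D}, Q \is monic & horner_alg b Q = 0.
Proof.
case=> -[|n] [e eP].
  have [c /eqP] := eP 1; rewrite big_ord0 => one0.
  by exfalso; move: one0; rewrite oner_eq0.
have /choice[M ME] : forall i, exists c : 'I_n.+1 -> D,
  b * e i = \sum_j c j *: e j by move=> i; apply: eP.
pose M' : 'M[D]_n.+1 := \matrix_(i, j) M i j.
have act (p : {poly D}) i : horner_alg b p * e i =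
    \sum_j (horner_mx M' p) i j *: e j.
  elim/poly_ind: p i => [|p c IHp] i.
    by rewrite !rmorph0 mul0r big1 // => j _; rewrite mxE scale0r.
  rewrite rmorphD rmorphM /= horner_algX horner_algC mulrDl -mulrA ME.
  rewrite [p * 'X]mulrC rmorphD rmorphM /= horner_mx_X horner_mx_C.
  under [RHS]eq_bigr do rewrite mxE scalerDl.
  rewrite big_split /=; congr (_ + _); last first.
    rewrite (bigD1 i) //= big1 => [|j ji]; rewrite mxE ?eqxx.
      by rewrite addr0 mulr1n -scalerAl mul1r.
    by rewrite eq_sym (negPf ji) mulr0n scale0r.
  rewrite mulr_sumr.
  under [LHS]eq_bigr do rewrite -scalerAr IHp scaler_sumr.
  rewrite exchange_big; apply: eq_bigr => j _ /=.
  rewrite -[M' * _]/(M' *m _) mxE scaler_suml; apply: eq_bigr => k _.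
  by rewrite scalerA mxE.
exists (char_poly M'); first exact: char_poly_monic.
have [c cE] := eP 1; rewrite -[LHS]mulr1 cE mulr_sumr big1 // => i _.
rewrite -scalerAr act Cayley_Hamilton big1 ?scaler0 // => j _.
by rewrite mxE scale0r.
Qed.

(** * The rings of integer-valued polynomials *)

Section IntK.
Variables (D : idomainType) (A : algType D) (tf : torsion_free A).
Local Notation K := {fraction D}.
Local Notation B := (FracAlg.type tf).
Local Notation iota := (@FracAlg.iota D A tf).
Local Notation tofrac := (@FracField.tofrac D).

Lemma horner_alg_iota (b : A) (Q : {poly D}) :
  horner_alg (iota b : B) (map_poly tofrac Q) = iota (horner_alg b Q).
Proof.
elim/poly_ind: Q => [|Q c IHQ]; first by rewrite !rmorph0.
rewrite !(rmorphD, rmorphM) /= map_polyX map_polyC /= !horner_algX !horner_algC.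
by rewrite IHQ FracAlg.iotaZ rmorph1.
Qed.

Lemma horner_alg_comp (b : B) (p x : {poly K}) :
  horner_alg b (p \Po x) = horner_alg (horner_alg b x) p.
Proof.
elim/poly_ind: p => [|p c IHp]; first by rewrite !rmorph0.
rewrite comp_polyD comp_polyM comp_polyX comp_polyC !(rmorphD, rmorphM) /=.
by rewrite !horner_algC horner_algX IHp.
Qed.

Lemma intK_const (S : set A) (d : D) : intK tf S (d%:F)%:P.
Proof.
by move=> a _; exists d%:A => //; rewrite horner_algC FracAlg.iotaZ rmorph1.
Qed.

Lemma mem_intK (S : set A) : [set` intK_pred tf S] = intK tf S.
Proof. by apply/seteqP; split=> f /= /asboolP. Qed.

Lemma intK_setU1 (S : set A) (b : A) :
  intK tf (b |` S) = intK tf [set b] `&` intK tf S.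
Proof.
apply/seteqP; split=> [f h|f [h1 h2] a [ab|aS]].
- by split=> [a ->|a aS]; apply: h; [left|right].
- exact: h1.
- exact: h2.
Qed.

(** Multiplication by [m] moves a coprime pair f, g into the ring. Comparing m f with m g yields f |
    e g, so e = k f by coprimality, and likewise 1 - e = h g; this is the Bezout relation.
    Conversely, dividing a pair by its gcd in K[X] makes it coprime, and e = k f compares the
    original pair. *)
Lemma prufer_intKP (S : set A) (m : {poly K}) : m != 0 ->
  (forall p, intK tf S (m * p)) ->
  prufer_domain (intK_ring tf S) <-> bezout_in (intK tf S).
Proof.
move=> m0 Sm.
have Sm' p : intK_pred tf S (m * p) by apply/asboolP.
have vP (f : intK_ring tf S) : intK tf S (val f) by case: f => f /= /asboolP.
have S0 : intK tf S 0 by have := vP 0; rewrite rmorph0.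
have S1 : intK tf S 1 by have := vP 1; rewrite rmorph1.
rewrite prufer_domainP; split=> [cmp f g fg|RP a b].
  (* The general argument cancels [f] and [g]; when one of them is 0, the other is a unit. *)
  have [f0|f0] := eqVneq f 0.
    move: fg => /Bezout_eq1_coprimepP[[u v] /= E].
    have {}E : v * g = 1 by rewrite -E f0 mulr0 add0r.
    exists v, 0; rewrite f0 E !mulr0 !mul0r addr0.
    split; [reflexivity | exact: S1 | exact: S0 | exact: S0 | exact: S0].
  have [g0|g0] := eqVneq g 0.
    move: fg => /Bezout_eq1_coprimepP[[u v] /= E].
    have {}E : u * f = 1 by rewrite -E g0 mulr0 addr0.
    exists 0, u; rewrite g0 E !mulr0 !mul0r add0r.
    split; [reflexivity | exact: S0 | exact: S0 | exact: S0 | exact: S1].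
  have [e [x [y [/(congr1 val) E1 /(congr1 val) E2]]]] :=
    cmp (IntK (Sm' f)) (IntK (Sm' g)).
  rewrite !rmorphM /= in E1; rewrite !rmorphM rmorphB rmorph1 /= in E2.
  have {}E1 : val e * g = f * val x.
    by apply: (mulfI m0); rewrite mulrCA E1 mulrA.
  have {}E2 : (1 - val e) * f = g * val y.
    by apply: (mulfI m0); rewrite mulrCA E2 mulrA.
  have /dvdpP[k kE] : f %| val e by rewrite -(Gauss_dvdpl _ fg) E1 dvdp_mulr.
  have /dvdpP[h hE] : g %| 1 - val e.
    by rewrite -(@Gauss_dvdpl _ _ f) 1?coprimep_sym // E2 dvdp_mulr.
  have kgE : k * g = val x.
    by apply: (mulfI f0); rewrite -E1 kE; ring.
  have hfE : h * f = val y.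
    by apply: (mulfI g0); rewrite -E2 hE; ring.
  exists h, k; rewrite -hE -kE kgE hfE subrK; split=> //.
  by have := vP (1 - e); rewrite rmorphB rmorph1.
have [/eqP a0|a0] := boolP (a == 0).
  by exists 0, 0, 0; rewrite a0 !mulr0 mul0r.
pose d := gcdp (val a) (val b).
have va0 : val a != 0 by rewrite -(inj_eq val_inj) rmorph0 in a0.
have fg : coprimep (val a %/ d) (val b %/ d) by rewrite coprimep_div_gcd ?va0.
have aE : val a %/ d * d = val a by rewrite divpK // dvdp_gcdl.
have bE : val b %/ d * d = val b by rewrite divpK // dvdp_gcdr.
move: fg aE bE; set f := _ %/ d; set g := _ %/ d => fg aE bE.
have [h [k [E hg hf kg kf]]] := RP _ _ fg.
exists (IntK (introT (asboolP _) kf)), (IntK (introT (asboolP _) kg)),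
  (IntK (introT (asboolP _) hf)).
split; apply: val_inj; rewrite !rmorphM /= -aE -bE; first by ring.
by rewrite -E; ring.
Qed.

Hypothesis fgA : finitely_generated A.

(** Take for [m] the minimal polynomial of [a] over K. A value x(a) in [A] is a root of some monic P
    over [D], so P(x) vanishes at [a] and is divisible by [m]. *)
Lemma intK1_conductor (a : A) : exists2 m : {poly K}, m != 0 &
  (forall p, intK tf [set a] (m * p)) /\
  (forall x, intK tf [set a] x -> integral_mod tofrac m x).
Proof.
have [Q Qm Qa] := fg_integral a fgA.
have [m m0 mP] : exists2 m : {poly K}, m != 0 &
    forall p, (horner_alg (iota a : B) p = 0) <-> (m %| p).
  apply: (@annihilator_gen _ _ _ (map_poly tofrac Q)).
    by rewrite monic_neq0 // monic_map.
  by rewrite /= horner_alg_iota Qa rmorph0.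
exists m => //; split=> [p _ ->|x /(_ a erefl)[b _ bE]].
  by exists 0 => //; rewrite rmorph0; symmetry; apply/mP; rewrite dvdp_mulr.
have [P Pm Pb] := fg_integral b fgA.
exists P => //; apply/mP.
by rewrite horner_alg_comp -bE horner_alg_iota Pb rmorph0.
Qed.

(* The factors of [m_b] shared with [m] impose no new condition: an element of
   Int(s) that is integral modulo the part of [m_b] prime to [m] is integral
   modulo [m_b], hence lies in the integrally closed ring Int({b}). *)
Lemma intK_seq (s : seq A) : exists2 m : {poly K}, m != 0 &
  [/\ forall p, intK tf [set` s] (m * p),
      forall x, intK tf [set` s] x -> integral_mod tofrac m x &
      (forall a, a \in s -> bezout_in (intK tf [set a])) ->
        bezout_in (intK tf [set` s])].
Proof.
elim: s => [|b s [m m0 [Sm Sint SB]]].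
  exists 1; first exact: oner_neq0.
  split=> [p a //|x _|_]; first exact: integral_mod1.
  by apply: bezout_inS (@bezout_inT _) => f _ a.
have [mb mb0 [bm bint]] := intK1_conductor b.
have -> : [set` b :: s] = b |` [set` s].
  apply/seteqP; split=> a /=; rewrite in_cons; first by move=> /predU1P.
  by case=> [->|->]; rewrite ?eqxx ?orbT.
rewrite intK_setU1.
exists (m * mb); first by rewrite mulf_neq0.
split=> [p|x [xb xs]|sB].
- by split; [rewrite mulrAC mulrC; apply: bm|rewrite -mulrA; apply: Sm].
- by apply: integral_modM; [apply: Sint|apply: bint].
have bB : bezout_in (intK tf [set b]) by apply: sB; rewrite mem_head.
have {}SB : bezout_in (intK tf [set` s]).
  by apply: SB => a sa; apply: sB; rewrite in_cons sa orbT.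
have [m' [n [m'mb cop mbm']]] := coprimep_part m mb0.
have subm' : intK tf [set b] `<=` integral_mod tofrac m'.
  by move=> x /bint; apply: integral_mod_dvd.
have SmD x y : intK tf [set` s] x -> intK tf [set` s] (x + m * y).
  move=> Sx; rewrite -mem_intK /= rpredD //; apply/asboolP => //; exact: Sm.
have m'D x y : integral_mod tofrac m' x -> integral_mod tofrac m' (x + m' * y).
  exact: integral_mod_add.
(* Int({b}) is only known to absorb multiples of [mb], which may share factors with [m]. It is
   therefore enlarged to the polynomials integral modulo [m'], which absorb multiples of [m'], and
   gluing with Int(s) becomes possible. *)
apply: bezout_inS (bezout_inI cop SmD m'D SB (bezout_inS subm' bB)).
move=> x [Sx m'x]; split=> //.
have: x \in intK_pred tf [set b].
  apply: (@bezout_in_integrally_closed _ _ tofrac _ mb); rewrite ?mem_intK //.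
  - by move=> p; apply/asboolP.
  - by move=> d; apply/asboolP; apply: intK_const.
  apply: integral_mod_dvd mbm' _; apply: integral_modM => //.
  by apply: integral_modX; apply: Sint.
by move/asboolP.
Qed.

End IntK.

Theorem corollary2p8 (D : idomainType) (A : algType D) (tf : torsion_free A)
    (S : set A) :
  prufer_domain D ->
  range (@FracField.tofrac D) <> [set: {fraction D}] ->
  finitely_generated A ->
  meets_frac_in_base tf ->
  finite_set S ->
  prufer_domain (intK_ring tf S) <->
  (forall a : A, S a -> prufer_domain (intK_ring tf [set a])).
Proof.
move=> _ _ fgA _ /finite_seqP[s ->].
have [m m0 [Sm _ SB]] := intK_seq tf fgA s.
rewrite (prufer_intKP m0 Sm).
have P1 a : prufer_domain (intK_ring tf [set a]) <-> bezout_in (intK tf [set a]).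
  by have [ma ma0 [am _]] := intK1_conductor tf fgA a; apply: prufer_intKP am.
split=> [sB a sa|pB]; last by apply: SB => a sa; apply/P1/pB.
by apply/P1; apply: bezout_inS sB => f fS _ ->; apply: fS.
Qed.
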